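(* Let $\alpha\in(0,1)$ and $\theta\ge-\alpha$, let $n\ge 1$, $m\ge 1$ and $1\le k\le n$ be integers with $\mathbb{P}_{\alpha,\theta}(K_n=k)>0$. Under the $(\alpha,\theta)$ Poisson-Dirichlet partition model, the conditional expectation of the number $K_m^{(n)}$ of new species in the additional $m$-sample, given that $K_n=k$ species were observed in the basic $n$-sample, is $$ \mathbb{E}_{\alpha,\theta}\big(K_m^{(n)}\,\big|\,K_n=k\big)=\left(\frac{\theta+k\alpha}{\alpha}\right)\left[\frac{(\theta+\alpha+n)_m}{(\theta+n)_m}-1\right]. $$
   Context: Notation: $(a)_b=a(a+1)\cdots(a+b-1)$ denotes the rising factorial, with $(a)_0=1$, and $(x)_{s\uparrow\alpha}=x(x+\alpha)(x+2\alpha)\cdots(x+(s-1)\alpha)$ denotes the generalized rising factorial, with $(x)_{0\uparrow\alpha}=1$. The $(\alpha,\theta)$ Poisson-Dirichlet partition model is the exchangeable random partition of $\mathbb{N}$, with law denoted $\mathbb{P}_{\alpha,\theta}$ and expectation $\mathbb{E}_{\alpha,\theta}$, such that for every $n\ge1$ and every partition of $\{1,\dots,n\}$ into $k$ blocks of sizes $n_1,\dots,n_k$, the probability that the restriction of the random partition to $\{1,\dots,n\}$ equals that partition is $$ p(n_1,\dots,n_k)=\frac{(\theta+\alpha)_{k-1\uparrow\alpha}}{(\theta+1)_{n-1}}\prod_{j=1}^k(1-\alpha)_{n_j-1}. $$ The integers represent successive observations $X_1,X_2,\dots$ and the blocks represent species. $K_n$ is the number of blocks of the restriction to $\{1,\dots,n\}$,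 i.e. the number of distinct species among $X_1,\dots,X_n$. $K_m^{(n)}=K_{n+m}-K_n$ is the number of new species (not represented among $X_1,\dots,X_n$) that appear in the additional sample $X_{n+1},\dots,X_{n+m}$. *)

(* Defs.v *)
From HB Require Import structures.
From mathcomp Require Import all_boot all_order all_algebra.
From mathcomp Require Import all_classical all_reals all_analysis.

Set Implicit Arguments.
Unset Strict Implicit.
Unset Printing Implicit Defensive.

Import Order.TTheory GRing.Theory Num.Theory.

Local Open Scope classical_set_scope.
Local Open Scope ring_scope.

(* (x)_{s \uparrow a} = x (x + a) ... (x + (s - 1) a) *)
Definition gen_rising (R : realType) (x : R) (s : nat) (a : R) : R :=
  \prod_(i < s) (x + i%:R * a).

(* (x)_s = x (x + 1) ... (x + s - 1) *)
Definition rising (R : realType) (x : R) (s : nat) : R :=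
  \prod_(i < s) (x + i%:R).

(* A random partition of {1, 2, ...}, encoded as a random equivalence relation.
   Indices are shifted by one: the natural number i stands for the integer
   i + 1, i.e. for the observation X_{i+1}, and 'I_n stands for {1, ..., n}. *)
Record random_partition (d : measure_display) (T : measurableType d) :=
  RandomPartition {
    same_block :> T -> rel nat ;
    same_block_equiv : forall w, equivalence_rel (same_block w) ;
    same_block_measurable :
      forall i j : nat, measurable [set w | same_block w i j] }.

Definition restr_partition (e : rel nat) (n : nat) : {set {set 'I_n}} :=
  equivalence_partition (fun i j : 'I_n => e i j) [set: 'I_n]%SET.

Section PoissonDirichlet.
Context {d : measure_display} {T : measurableType d} {R : realType}.

Definition nb_blocks (Pi : random_partition T) (n : nat) (w : T) : nat :=
  #|restr_partition (Pi w) n|.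

(* K_m^{(n)} *)
Definition nb_new_blocks (Pi : random_partition T) (n m : nat) (w : T) : R :=
  (nb_blocks Pi (n + m) w)%:R - (nb_blocks Pi n w)%:R.

(* p(n_1, ..., n_k) for s = [:: n_1; ...; n_k], where n = sumn s and
   k = size s. *)
Definition pd_eppf (alpha theta : R) (s : seq nat) : R :=
  gen_rising (theta + alpha) (size s).-1 alpha / rising (theta + 1) (sumn s).-1
  * \prod_(j <- s) rising (1 - alpha) j.-1.

Definition block_sizes (n : nat) (B : {set {set 'I_n}}) : seq nat :=
  [seq #|b : {set 'I_n}| | b <- enum B].

(* Pi has law P_{alpha, theta}. Exchangeability is not a separate clause: it
   follows from the formula, which depends on the block sizes only and is
   symmetric in them. *)
Definition is_poisson_dirichlet (P : probability T R) (alpha theta : R)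
    (Pi : random_partition T) : Prop :=
  forall (n : nat) (B : {set {set 'I_n}}),
    (1 <= n)%N -> finset.partition B [set: 'I_n]%SET ->
    P [set w | restr_partition (Pi w) n = B]
      = (pd_eppf alpha theta (block_sizes B))%:E.

(* E(X | A) = E(X 1_A) / P(A), meaningful when P(A) > 0. *)
Definition cond_expectation (P : probability T R) (X : T -> R) (A : set T)
    : \bar R :=
  ('E_P[(fun w => X w * \1_A w)%R] / P A)%E.

End PoissonDirichlet.

(* Main.v *)
(* Given the restriction of the partition to the first [n] indices, with
   [K_n] blocks, the next index is new with probability
   [(theta + alpha K_n) / (theta + n)]. Hence the conditional mean of
   [theta + alpha K_n] is multiplied by [1 + alpha / (theta + n)] at each step,
   and over [m] steps these deterministic factors telescope to
   [(theta + alpha + n)_m / (theta + n)_m]. *)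

Require Import Defs.
From HB Require Import structures.
From mathcomp Require Import all_boot all_order all_algebra.
From mathcomp Require Import all_classical all_reals all_analysis.
From mathcomp Require Import ring lra.

Set Implicit Arguments.
Unset Strict Implicit.
Unset Printing Implicit Defensive.

Import Order.TTheory GRing.Theory Num.Theory.

(** * Adjoining a singleton block to a partition *)

Definition new_block (e : rel nat) (n : nat) : bool :=
  [forall i : 'I_n, ~~ e i n].

Definition add_singleton (n : nat) (B : {set {set 'I_n}}) : {set {set 'I_n.+1}} :=
  ([set ord_max]
     |: [set (widen_ord (leqnSn n) @: b)%SET | b : {set 'I_n} in B])%SET.

Lemma widen_ordS_inj n : injective (widen_ord (leqnSn n)).
Proof. by move=> i j /(congr1 val) /= /val_inj. Qed.

Lemma ord_max_widenS n (i : 'I_n) : (ord_max == widen_ord (leqnSn n) i) = false.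
Proof. by apply/eqP => /(congr1 val) /= h; have := ltn_ord i; rewrite -h ltnn. Qed.

Lemma ord_max_notin_imset_widenS n (b : {set 'I_n}) :
  ord_max \notin (widen_ord (leqnSn n) @: b)%SET.
Proof. by apply/imsetP => -[i _ /eqP]; rewrite ord_max_widenS. Qed.

Lemma singleton_ord_max_notin n (B : {set {set 'I_n}}) :
  [set ord_max]%SET \notin
    [set (widen_ord (leqnSn n) @: b)%SET | b : {set 'I_n} in B]%SET.
Proof.
apply/imsetP => -[b _ h]; have := ord_max_notin_imset_widenS b.
by rewrite -h set11.
Qed.

(** Removing the block [[set ord_max]] leaves the images of the old blocks, and taking images under
    an injection is itself injective. *)
Lemma add_singleton_inj n : injective (@add_singleton n).
Proof.
move=> B C h; apply: (imset_inj (imset_inj (@widen_ordS_inj n))).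
by rewrite -(setU1K (singleton_ord_max_notin B)) -/(add_singleton B) h setU1K
  ?singleton_ord_max_notin.
Qed.

Lemma card_add_singleton n (B : {set {set 'I_n}}) :
  #|add_singleton B| = #|B|.+1.
Proof.
rewrite cardsU1 singleton_ord_max_notin card_imset//.
exact: imset_inj (@widen_ordS_inj n).
Qed.

Lemma setT_ordS n : [set: 'I_n.+1]%SET =
  (ord_max |: (widen_ord (leqnSn n) @: [set: 'I_n]))%SET.
Proof.
apply/setP => i; rewrite !inE; apply/esym.
case: (ltnP i n) => [lin|lni]; apply/orP.
  by right; apply/imsetP; exists (Ordinal lin) => //; apply: val_inj.
by left; apply/eqP/val_inj/eqP; rewrite /= eqn_leq lni -ltnS ltn_ord.
Qed.

Lemma partition_add_singleton n (B : {set {set 'I_n}}) :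
  finset.partition B [set: 'I_n]%SET ->
  finset.partition (add_singleton B) [set: 'I_n.+1]%SET.
Proof.
move=> /and3P[/eqP covB tB B0]; rewrite setT_ordS; apply: partitionU1.
- apply/and3P; split.
  + rewrite cover_imset -covB /cover eq_sym; apply/eqP.
    by rewrite (big_morph _ (imsetU _) (imset0 _)).
  + apply/finset.trivIsetP => _ _ /imsetP[b bB ->] /imsetP[c cB ->] bc.
    rewrite (imset_disjoint (@widen_ordS_inj n)).
    by apply: (finset.trivIsetP tB) => //; apply: contraNneq bc => ->.
  + apply/imsetP => -[b bB /esym/eqP]; rewrite imset_eq0 => /eqP b0.
    by rewrite -b0 bB in B0.
- by apply/set0Pn; exists ord_max; rewrite set11.
- by rewrite disjoints1 ord_max_notin_imset_widenS.
Qed.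

(** * Restrictions of an equivalence relation to initial segments *)

Section RestrPartition.
Variable e : rel nat.
Hypothesis e_equiv : equivalence_rel e.

Let e_refl i : e i i. Proof. exact: (e_equiv i i i).1. Qed.

Let e_sym i j : e i j = e j i.
Proof. by apply/idP/idP => h; rewrite -((e_equiv _ _ _).2 h) e_refl. Qed.

Lemma restr_partitionP n :
  finset.partition (restr_partition e n) [set: 'I_n]%SET.
Proof. by apply: equivalence_partitionP => i j k _ _ _; apply: e_equiv. Qed.

Lemma restr_partition_pblock n (i j : 'I_n) :
  (j \in finset.pblock (restr_partition e n) i) = e i j.
Proof.
by apply: finset.pblock_equivalence_partition => // x y z _ _ _; apply: e_equiv.
Qed.

(* Blocks correspond to their least elements. *)
Lemma card_restr_partition n :
  #|restr_partition e n| = \sum_(i < n) new_block e i.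
Proof.
rewrite -big_mkcond /= sum1_card.
pose cl (i : 'I_n) := [set j in [set: 'I_n] | e i j]%SET.
have -> : restr_partition e n = (cl @: [set i : 'I_n | new_block e i])%SET.
  apply/setP => b; apply/imsetP/imsetP => [[i _ ->]|[i _ ->]]; last by exists i.
  (* The least member [j] of the class of [i] is new: an earlier index equivalent to [j] would be a
     smaller member of that class. *)
  case: (@arg_minnP _ i (fun j : 'I_n => e i j) val (e_refl i)) => j eij jmin.
  exists j.
    rewrite inE; apply/forallP => l; apply/negP => elj.
    have := jmin (widen_ord (ltnW (ltn_ord j)) l).
    rewrite /= leqNgt ltn_ord => /(_ _)/notF; apply.
    by rewrite (e_equiv i j l).2// e_sym.
  by apply/setP => l; rewrite !inE /= (e_equiv i j l).2.
rewrite card_in_imset; first by apply: eq_card => i; rewrite inE.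
(* For injectivity, two new indices with the same class are each at most the other, since neither
   has an earlier equivalent. *)
suff le i j : i \in [set i : 'I_n | new_block e i]%SET -> cl i = cl j -> i <= j.
  by move=> i j iN jN h; apply/val_inj/eqP; rewrite eqn_leq !le.
rewrite inE => /forallP iN /setP/(_ j); rewrite !inE e_refl /= leqNgt => eij.
by apply/negP => ji; have := iN (Ordinal ji); rewrite e_sym /= eij.
Qed.

Lemma card_restr_partitionS n :
  #|restr_partition e n.+1| = #|restr_partition e n| + new_block e n.
Proof. by rewrite !card_restr_partition big_ord_recr. Qed.

(** The class of a new index is a singleton, and no class of an earlier index gains it. *)
Lemma restr_partition_new n : new_block e n ->
  restr_partition e n.+1 = add_singleton (restr_partition e n).
Proof.
move=> /forallP eN; rewrite /restr_partition /equivalence_partition setT_ordS.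
rewrite imsetU1 -imset_comp /add_singleton -imset_comp.
have mem_cl (i : nat) (j : 'I_n.+1) :
    (j \in [set y in ord_max |: (widen_ord (leqnSn n) @: [set: 'I_n]) | e i y]%SET)
    = e i j.
  by rewrite -setT_ordS !inE.
have sum_ord (j : 'I_n.+1) : j = ord_max \/ exists i, j = widen_ord (leqnSn n) i.
  have := finset.in_setT j.
  by rewrite setT_ordS !inE => /orP[/eqP|/imsetP[i]]; [left|right; exists i].
congr (_ |: _)%SET.
  apply/setP => j; rewrite mem_cl inE.
  by case: (sum_ord j) => [->|[i ->]]; rewrite ?eqxx ?e_refl//= eq_sym
    ord_max_widenS e_sym (negbTE (eN i)).
apply: eq_imset => i /=; apply/setP => j; rewrite mem_cl.
case: (sum_ord j) => [->|[l ->]] /=.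
  by rewrite (negbTE (eN i)) (negbTE (ord_max_notin_imset_widenS _)).
by rewrite mem_imset ?inE//; apply: widen_ordS_inj.
Qed.

(** Makes the arrival of a new block after a given restriction a single restriction event, whose
    probability the law prescribes. *)
Lemma restr_partition_add_singleton n (B : {set {set 'I_n}}) :
  restr_partition e n.+1 = add_singleton B <->
  restr_partition e n = B /\ new_block e n.
Proof.
split=> [h|[<-]]; last exact: restr_partition_new.
have eN : new_block e n.
  apply/forallP => i; apply/negP => ein.
  (* The block of [ord_max] is the added singleton, whereas an earlier index equivalent to [n] would
     have to lie in it. *)
  have blk : finset.pblock (restr_partition e n.+1) ord_max = [set ord_max]%SET.
    apply: finset.def_pblock; rewrite ?set11//; last by rewrite h setU11.
    exact: finset.partition_trivIset (restr_partitionP _).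
  have := restr_partition_pblock (@ord_max n) (widen_ord (leqnSn n) i).
  by rewrite blk inE /= eq_sym ord_max_widenS e_sym ein.
by split=> //; apply: add_singleton_inj; rewrite -restr_partition_new.
Qed.

End RestrPartition.

(** The blocks over [p] indices determine the relation on these indices, hence on the first [n]. *)
Lemma eq_restr_partition (e e' : rel nat) n p :
  equivalence_rel e -> equivalence_rel e' -> n <= p ->
  restr_partition e p = restr_partition e' p ->
  restr_partition e n = restr_partition e' n.
Proof.
move=> eE e'E np h; apply: eq_imset => i; apply/setP => j; rewrite !inE /=.
have := restr_partition_pblock eE (widen_ord np i) (widen_ord np j).
by rewrite h (restr_partition_pblock e'E) /= => ->.
Qed.

Local Open Scope classical_set_scope.
Local Open Scope ring_scope.

(** * Prediction rule from the partition probability function *)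

Section ExchangeablePartitionProbability.
Context {R : realType}.
Implicit Types alpha theta : R.

Lemma rising0 (x : R) : rising x 0 = 1.
Proof. by rewrite /rising big_ord0. Qed.

Lemma risingS (x : R) s : rising x s.+1 = rising x s * (x + s%:R).
Proof. by rewrite /rising big_ord_recr. Qed.

Lemma gen_risingS (x : R) s alpha :
  gen_rising x s.+1 alpha = gen_rising x s alpha * (x + s%:R * alpha).
Proof. by rewrite /gen_rising big_ord_recr. Qed.

(** Indexing by the set [B] removes the dependence on the order in which [enum] lists the blocks. *)
Lemma pd_eppf_block_sizes alpha theta n (B : {set {set 'I_n}}) :
  finset.partition B [set: 'I_n]%SET ->
  pd_eppf alpha theta (block_sizes B)
    = gen_rising (theta + alpha) #|B|.-1 alpha / rising (theta + 1) n.-1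
      * \prod_(b in B) rising (1 - alpha) #|b|.-1.
Proof.
move=> Bpart; rewrite /pd_eppf /block_sizes size_map -cardE sumnE !big_map.
by rewrite !big_enum /= -(card_partition Bpart) cardsT card_ord.
Qed.

(** The prediction rule: a singleton contributes [rising _ 0], which is 1, so only the numerator and
    the denominator in front change, each gaining one last factor. *)
Lemma pd_eppf_add_singleton alpha theta n (B : {set {set 'I_n}}) :
  (1 <= n)%N -> finset.partition B [set: 'I_n]%SET ->
  pd_eppf alpha theta (block_sizes (add_singleton B))
    = pd_eppf alpha theta (block_sizes B)
      * ((theta + alpha * #|B|%:R) / (theta + n%:R)).
Proof.
(* From here on the sample size is [n.+1]. Since [B] is nonempty, [#|B|.-1] is a true
   predecessor. *)
case: n B => // n B _ Bpart; have B_gt0 : (0 < #|B|)%N.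
  apply/card_gt0P; have := finset.in_setT (@ord0 n).
  by rewrite -(cover_partition Bpart) => /finset.bigcupP[b bB _]; exists b.
rewrite !pd_eppf_block_sizes//; last exact: partition_add_singleton.
rewrite card_add_singleton /= big_setU1 ?singleton_ord_max_notin//=.
rewrite big_imset /=; last by move=> b c _ _; apply: (imset_inj (@widen_ordS_inj _)).
rewrite cards1 /= rising0 mul1r risingS.
under eq_bigr do rewrite (card_imset _ (@widen_ordS_inj _)).
(* The last factor is [theta + alpha] plus [#|B| - 1] times [alpha]. *)
have -> : gen_rising (theta + alpha) #|B| alpha =
    gen_rising (theta + alpha) #|B|.-1 alpha * (theta + alpha * #|B|%:R).
  by rewrite -{1}(prednK B_gt0) gen_risingS -{4}(prednK B_gt0) -natr1; ring.
rewrite invfM -[in theta + n.+1%:R]natr1 [n%:R + 1]addrC [theta + (1 + _)]addrA.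
ring.
Qed.

End ExchangeablePartitionProbability.

(** * Expectation of finite combinations of indicators *)

Section ExpectationOfSimpleFunction.
Context {d : measure_display} {T : measurableType d} {R : realType}.
Variables (P : probability T R) (I : finType) (c : I -> R) (U : I -> set T).
Hypothesis mU : forall i, measurable (U i).

Lemma Lfun_sum_indic : (fun w => \sum_i c i * \1_(U i) w) \in Lfun P 1.
Proof.
apply/Lfun1_integrable; rewrite /comp.
under eq_fun do rewrite -sumEFin.
apply: integrable_sum => // i _; under eq_fun do rewrite EFinM.
by apply: integrableZl => //; apply: integrable_indic.
Qed.

Lemma expectation_sum_indic :
  'E_P[(fun w => \sum_i c i * \1_(U i) w)%R]%E = (\sum_i c i * fine (P (U i)))%:E.
Proof.
rewrite unlock; under eq_integral do rewrite -sumEFin.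
rewrite integral_sum//= => [|i]; last first.
  under eq_fun do rewrite EFinM.
  by apply: integrableZl => //; apply: integrable_indic.
rewrite -sumEFin; apply: eq_bigr => i _.
under eq_integral do rewrite EFinM.
rewrite integralZl//; last exact: integrable_indic.
by rewrite integral_indic// setIT EFinM fineK// fin_num_measure.
Qed.

End ExpectationOfSimpleFunction.

(** * Events and expectations determined by a restriction *)

Section RandomPartition.
Context {d : measure_display} {T : measurableType d} {R : realType}.
Variables (P : probability T R) (Pi : random_partition T).

Definition restr_event n (B : {set {set 'I_n}}) : set T :=
  [set w | restr_partition (Pi w) n = B].

Definition new_event n : set T := [set w | new_block (Pi w) n].

(* [A] lies in the sigma-algebra of the restriction to the first [n] indices. *)
Definition restr_determined n (A : set T) : Prop :=
  forall w w', restr_partition (Pi w) n = restr_partition (Pi w') n -> A w -> A w'.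

(** A nonempty event of this kind contains some [w0], and is then the finite intersection of the
    events that a given pair is related as it is under [w0]. *)
Lemma measurable_restr_event n (B : {set {set 'I_n}}) :
  measurable (restr_event B).
Proof.
have [[w0 w0B]|noB] := pselect (exists w, restr_event B w); last first.
  rewrite (_ : restr_event B = set0) //.
  by apply/seteqP; split=> // w wB; case: noB; exists w.
rewrite (_ : restr_event B = \bigcap_(p in [set: 'I_n * 'I_n])
    [set w | Pi w p.1 p.2 = Pi w0 p.1 p.2]).
  apply: fin_bigcap_measurable => [|p _]; first exact: finite_finset.
  have mp := same_block_measurable Pi p.1 p.2.
  case: (Pi w0 p.1 p.2) => //.
  rewrite (_ : mkset _ = ~` [set w | Pi w p.1 p.2]); first exact: measurableC.
  by apply/seteqP; split=> w /=; [move=> -> | move/negP/negbTE].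
apply/seteqP; split=> [w wB [i j] _ /=|w h].
  rewrite -(restr_partition_pblock (same_block_equiv Pi w)).
  by rewrite -(restr_partition_pblock (same_block_equiv Pi w0)) wB w0B.
rewrite /restr_event /= -w0B; apply: eq_imset => i.
by apply/setP => j; rewrite !inE; apply: (h (i, j)).
Qed.

(** Such an [A] is the finite union of the restriction events that it meets. *)
Lemma measurable_restr_determined n A : restr_determined n A -> measurable A.
Proof.
move=> dA; rewrite (_ : A = \bigcup_(B in [set B : {set {set 'I_n}} |
    exists2 w, A w & restr_event B w]) restr_event B).
  apply: fin_bigcup_measurable => [|B _]; first exact: finite_finset.
  exact: measurable_restr_event.
apply/seteqP; split=> [w Aw|w [B [w' Aw' w'B] wB]].
  by exists (restr_partition (Pi w) n) => //; exists w.
by apply: dA Aw'; rewrite w'B wB.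
Qed.

Lemma restr_determinedW n p A : (n <= p)%N ->
  restr_determined n A -> restr_determined p A.
Proof.
move=> np dA w w' /(eq_restr_partition (same_block_equiv _ w)
  (same_block_equiv _ w') np); exact: dA.
Qed.

Lemma restr_determined_nb_blocks n k :
  restr_determined n [set w | nb_blocks Pi n w = k].
Proof. by move=> w w' h /=; rewrite /nb_blocks h. Qed.

(** The restriction to [n.+1] indices fixes the block counts at [n] and [n.+1], and their difference
    tells whether index [n] is new. *)
Lemma restr_determined_new_event n : restr_determined n.+1 (new_event n).
Proof.
move=> w w' h; rewrite /new_event /=.
have := congr1 (fun B => #|pred_of_set B|) h.
rewrite !card_restr_partitionS; [|exact: same_block_equiv..].
rewrite (eq_restr_partition (same_block_equiv _ w) (same_block_equiv _ w') _ h)//.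
by move=> /addnI; do 2![case: (new_block _ _)].
Qed.

Lemma nb_blocksS n w :
  (nb_blocks Pi n.+1 w)%:R = (nb_blocks Pi n w)%:R + \1_(new_event n) w :> R.
Proof.
rewrite /nb_blocks card_restr_partitionS; last exact: same_block_equiv.
rewrite natrD indicE; congr (_ + _%:R).
by apply/esym; congr nat_of_bool; apply/idP/idP; rewrite inE.
Qed.

(** Exactly one [B] is the realised restriction. Functions of the block count thus become finite
    combinations of indicators. *)
Lemma sum_restr_event (g : nat -> R) n A w :
  \sum_(B : {set {set 'I_n}}) g #|B| * \1_(A `&` restr_event B) w
    = g (nb_blocks Pi n w) * \1_A w.
Proof.
rewrite (bigD1 (restr_partition (Pi w) n)) //= big1 ?addr0.
  by rewrite indicI /= [\1_(restr_event _) w]indicE mem_set// mulr1.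
move=> B nB; rewrite indicI /= [\1_(restr_event _) w]indicE memNset ?mulr0//.
by move=> wB; rewrite -wB eqxx in nB.
Qed.

Lemma expectation_nb_blocks (g : nat -> R) n A : measurable A ->
  'E_P[(fun w => g (nb_blocks Pi n w) * \1_A w)%R]%E =
  (\sum_(B : {set {set 'I_n}}) g #|B| * fine (P (A `&` restr_event B)))%:E.
Proof.
move=> mA; under eq_fun do rewrite -sum_restr_event.
apply: expectation_sum_indic => B.
by apply: measurableI => //; apply: measurable_restr_event.
Qed.

Lemma Lfun_nb_blocks (g : nat -> R) n A : measurable A ->
  (fun w => g (nb_blocks Pi n w) * \1_A w) \in Lfun P 1.
Proof.
move=> mA; under eq_fun do rewrite -sum_restr_event.
apply: Lfun_sum_indic => B.
by apply: measurableI => //; apply: measurable_restr_event.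
Qed.

Lemma sum_measure_restr_event n A : measurable A ->
  \sum_(B : {set {set 'I_n}}) fine (P (A `&` restr_event B)) = fine (P A).
Proof.
move=> mA; have := expectation_nb_blocks (fun=> 1) n mA.
under eq_fun do rewrite mul1r.
rewrite expectation_indic// => ->.
by apply: eq_bigr => B _; rewrite mul1r.
Qed.

(** Terms with [#|B|] different from [k] vanish, because [A] is then disjoint from
    [restr_event B]. *)
Lemma sum_nb_blocks_event (g : nat -> R) n k :
  let A := [set w | nb_blocks Pi n w = k] in
  \sum_(B : {set {set 'I_n}}) g #|B| * fine (P (A `&` restr_event B))
    = g k * fine (P A).
Proof.
move=> A; have mA : measurable A.
  exact: measurable_restr_determined (@restr_determined_nb_blocks n k).
rewrite -(sum_measure_restr_event n mA) mulr_sumr; apply: eq_bigr => B _.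
have [<-//|Bk] := eqVneq #|B| k.
rewrite (_ : A `&` restr_event B = set0) ?measure0 ?mulr0//.
apply/seteqP; split=> // w [wk wB]; case/eqP: Bk.
by rewrite -wB -wk.
Qed.

(** * Recursion for the mean under the Poisson-Dirichlet law *)

Section PoissonDirichletLaw.
Variables alpha theta : R.
Hypothesis Pi_law : is_poisson_dirichlet P alpha theta Pi.

(** As [A] is determined by the restriction, it contains [restr_event B] or misses it. In the first
    case the prediction rule applies. *)
Lemma measure_new_restr_event n (B : {set {set 'I_n}}) A :
  (1 <= n)%N -> restr_determined n A ->
  fine (P (A `&` new_event n `&` restr_event B)) =
  (theta + alpha * #|B|%:R) * fine (P (A `&` restr_event B)) / (theta + n%:R).
Proof.
move=> n_gt0 dA; rewrite setIAC.
have [[w0 [Aw0 w0B]]|noB] := pselect (exists w, (A `&` restr_event B) w); last first.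
  rewrite (_ : A `&` restr_event B = set0) ?set0I ?measure0 ?mulr0 ?mul0r//.
  by apply/seteqP; split=> // w wB; case: noB; exists w.
(* The law speaks of genuine partitions only; [B] is one because it is realised at [w0]. *)
have Bpart : finset.partition B [set: 'I_n]%SET.
  by rewrite -w0B; apply/restr_partitionP/same_block_equiv.
have -> : A `&` restr_event B = restr_event B.
  by apply/seteqP; split=> [w []//|w wB]; split=> //; apply: dA Aw0; rewrite w0B wB.
have -> : restr_event B `&` new_event n = restr_event (add_singleton B).
  by apply/seteqP; split=> w /=; rewrite /restr_event /new_event /= => h;
    apply/(restr_partition_add_singleton (same_block_equiv Pi w)).
rewrite /restr_event !Pi_law//; last exact: partition_add_singleton.
by rewrite pd_eppf_add_singleton//= mulrA [in RHS](mulrC (_ + _)).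
Qed.

Variable A : set T.

(* [x n] is the expectation of [(theta + alpha * K_n) * 1_A]. *)
Let x n := \sum_(B : {set {set 'I_n}})
  (theta + alpha * #|B|%:R) * fine (P (A `&` restr_event B)).

Lemma measure_new_event n : (1 <= n)%N -> restr_determined n A ->
  fine (P (A `&` new_event n)) = x n / (theta + n%:R).
Proof.
move=> n_gt0 dA; have mA := measurable_restr_determined dA.
rewrite -(@sum_measure_restr_event n); last first.
  by apply: measurableI => //; apply/measurable_restr_determined/restr_determined_new_event.
by rewrite mulr_suml; apply: eq_bigr => B _; rewrite measure_new_restr_event.
Qed.

(** The block count grows by the indicator of [new_event n], so the mean grows by [alpha] times the
    probability of [A] and a new block, which is again a multiple of [x n]. *)
Lemma mean_nb_blocksS n : (1 <= n)%N -> restr_determined n A ->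
  x n.+1 = x n * (1 + alpha / (theta + n%:R)).
Proof.
move=> n_gt0 dA; have mA := measurable_restr_determined dA.
have mN : measurable (A `&` new_event n).
  by apply: measurableI => //; apply/measurable_restr_determined/restr_determined_new_event.
pose g (b : nat) : R := theta + alpha * b%:R.
(* [x n.+1] and [x n] sum over partitions of different sets; they become comparable as expectations
   on the same space. *)
apply: EFin_inj; rewrite -(expectation_nb_blocks g n.+1 mA).
rewrite (_ : (fun w => _) = (fun w => g (nb_blocks Pi n w) * \1_A w) \+
    (alpha \o* \1_(A `&` new_event n))); last first.
  apply/funext => w /=; rewrite indicI /= /g nb_blocksS; ring.
have iN : (\1_(A `&` new_event n) : T -> R) \in Lfun P 1.
  exact/Lfun1_integrable/integrable_indic.
rewrite expectationD; [|exact: Lfun_nb_blocks|]; last first.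
  apply/Lfun1_integrable.
  have := integrableZl measurableT alpha (integrable_indic P mN).
  by apply: eq_integrable => // w _ /=; rewrite -EFinM mulrC.
rewrite expectationZl// expectation_indic// expectation_nb_blocks//.
rewrite -[P _]fineK ?fin_num_measure// measure_new_event// -EFinM -EFinD.
by congr EFin; rewrite /x /g; ring.
Qed.

Lemma mean_nb_blocksD n m : 0 < theta + n%:R -> (1 <= n)%N ->
  restr_determined n A ->
  x (n + m) = x n * (rising (theta + alpha + n%:R) m / rising (theta + n%:R) m).
Proof.
move=> tn_gt0 n_gt0 dA; elim: m => [|m IHm].
  by rewrite addn0 !rising0 divr1 mulr1.
rewrite addnS mean_nb_blocksS ?ltn_addr//; last first.
  exact: restr_determinedW (leq_addr _ _) dA.
rewrite IHm !risingS invfM natrD addrA.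
(* Needed to put the one-step factor over a common denominator, as the next factor of the rising
   quotient. *)
have tnm_neq0 : theta + n%:R + m%:R != 0 by rewrite gt_eqF// ltr_wpDr.
have -> : 1 + alpha / (theta + n%:R + m%:R) =
    (theta + alpha + n%:R + m%:R) / (theta + n%:R + m%:R) by field.
by ring.
Qed.

End PoissonDirichletLaw.

End RandomPartition.

(** * Conditioning on the observed number of blocks *)

Theorem proposition3 (R : realType) (d : measure_display)
    (T : measurableType d) (P : probability T R)
    (alpha theta : R) (Pi : random_partition T) (n m k : nat)
    (alpha_gt0 : 0 < alpha) (alpha_lt1 : alpha < 1)
    (theta_ge : - alpha <= theta)
    (Pi_law : is_poisson_dirichlet P alpha theta Pi)
    (n_ge1 : (1 <= n)%N) (m_ge1 : (1 <= m)%N)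
    (k_ge1 : (1 <= k)%N) (k_le_n : (k <= n)%N)
    (PKn_gt0 : (0 < P [set w | nb_blocks Pi n w = k])%E) :
  cond_expectation P (nb_new_blocks Pi n m) [set w | nb_blocks Pi n w = k]
  = ((theta + k%:R * alpha) / alpha
     * (rising (theta + alpha + n%:R) m / rising (theta + n%:R) m - 1))%:E.
Proof.
set A := [set w | nb_blocks Pi n w = k].
have dA : restr_determined Pi n A := @restr_determined_nb_blocks _ _ Pi n k.
have mA : measurable A := measurable_restr_determined dA.
(* Here [theta >= - alpha > -1] and [n >= 1]. *)
have tn_gt0 : 0 < theta + n%:R.
  have : 1 <= n%:R :> R by rewrite ler1n.
  by lra.
set r := rising _ m / _.
have PA_gt0 : 0 < fine (P A).
  by rewrite -lte_fin fineK// fin_num_measure.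
rewrite /cond_expectation.
(* On [A] the count at [n] is the constant [k]; off [A] both sides vanish. *)
rewrite (_ : (fun w => _) =
    fun w => ((nb_blocks Pi (n + m) w)%:R - k%:R) * \1_A w); last first.
  apply/funext => w; rewrite /nb_new_blocks !indicE.
  case: (boolP (w \in A)) => [|_]; last by rewrite !mulr0.
  by rewrite inE => ->.
rewrite (expectation_nb_blocks P Pi (fun b => b%:R - k%:R) _ mA) -[P A]fineK ?fin_num_measure//.
(* The extended-real inverse of [P A] is the real one because [P A] is nonzero. *)
rewrite inver gt_eqF// -EFinM; congr EFin.
have := mean_nb_blocksD Pi_law m tn_gt0 n_ge1 dA; rewrite (sum_nb_blocks_event P Pi (fun b => theta + alpha * b%:R)) -/A -/r.
(* Splits [theta + alpha * b] as [alpha * (b - k)] plus the constant [theta + alpha * k], to isolate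
   the mean number of new blocks. *)
have -> : \sum_(B : {set {set 'I_(n + m)}})
    (theta + alpha * #|B|%:R) * fine (P (A `&` restr_event Pi B))
  = alpha * (\sum_(B : {set {set 'I_(n + m)}})
      (#|B|%:R - k%:R) * fine (P (A `&` restr_event Pi B)))
    + (theta + alpha * k%:R) * fine (P A).
  rewrite -(sum_measure_restr_event P Pi (n + m) mA) !mulr_sumr -big_split /=.
  by apply: eq_bigr => B _; ring.
set S := \sum_B _ => h.
have alpha_neq0 : alpha != 0 by rewrite gt_eqF.
have PA_neq0 : fine (P A) != 0 by rewrite gt_eqF.
have -> : S = ((theta + alpha * k%:R) * fine (P A) * r
               - (theta + alpha * k%:R) * fine (P A)) / alpha.
  by rewrite -h addrK mulrC mulKf.
by field; rewrite alpha_neq0.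
Qed.
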